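(* Let $f(C_1,C_2)\in F$ be written as \[f(C_1,C_2)=\sum_{n,m\ge0}\alpha_{nm}C_1^nC_2^m+\sum_{j}C_1^{n_j}C_2^{m_j}\sum_i\beta_{ij}u_{ij}+g(C_1,C_2),\] where $\alpha_{nm},\beta_{ij}\in K$, the pairs $(n_j,m_j)$ are distinct, each $u_{ij}$ is the evaluation at $(C_1,C_2)$ of a left normed commutator of the form $[t_1,t_2,t_{s_3},\ldots,t_{s_l}]$ ($s_q\in\{1,2\}$), and $g(C_1,C_2)=\sum_u\gamma_uC_1^{a}C_2^{b}u_1\cdots u_k$ ($\gamma_u\in K$) is a linear combination of products of powers of $C_1,C_2$ with at least two ($k\ge 2$) such commutators $u_1,\dots,u_k$ of degree at least two. For each $i,j$ let $r_{ij}=\deg_{t_1}u_{ij}$, $s_{ij}=\deg_{t_2}u_{ij}$, and let $I_{ij}$ be the set of all indices $p$ with $\deg_{t_1}u_{pj}=r_{ij}$ and $\deg_{t_2}u_{pj}=s_{ij}$. Then $f(C_1,C_2)$ is central in $F$ if and only if $\alpha_{nm}=0$ for all $n,m$ with $n+m\ge1$ and, for every $i$ and $j$, $\sum_{p\in I_{ij}}\beta_{pj}=0$. Furthermore, $f(C_1,C_2)$ is strongly central if and only if it is central and $\alpha_{00}=0$.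
   Context: $K$ is an infinite field of characteristic different from 2. Let $X=\{x_1,x_2,x_1',x_2'\}$ and $Y=\{y_1,y_2,y_1',y_2'\}$, and let $K[X;Y]\cong K[X]\otimes_K E(Y)$ be the free supercommutative algebra: the $x$'s are even commuting variables, the $y$'s are odd pairwise anticommuting variables, and $E(Y)$ is the Grassmann algebra on the vector space with basis $Y$. Put $C_1=\begin{pmatrix} x_1&y_1\\ y_1'&x_1'\end{pmatrix}$, $C_2=\begin{pmatrix} x_2&y_2\\ y_2'&x_2'\end{pmatrix}$, and let $F=K[C_1,C_2]$ be the unital $K$-subalgebra of $M_2(K[X;Y])$ generated by $C_1,C_2$ (isomorphic to the relatively free algebra of rank 2 of $M_{11}(E)$); $C_i^0$ is the identity matrix. Commutators are $[a,b]=ab-ba$, left normed: $[a_1,\ldots,a_k]=[[a_1,\ldots,a_{k-1}],a_k]$; $t_1,t_2$ are free noncommuting variables. An element $a\in F$ is strongly central if $a$ is central in $F$ and $ab$ is central in $F$ for every $b\in F$. *)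

(* Defs.v *)
From HB Require Import structures.
From mathcomp Require Import all_boot all_order all_algebra.
From mathcomp Require Import mpoly.
Set Implicit Arguments. Unset Strict Implicit. Unset Printing Implicit Defensive.
Import Order.TTheory GRing.Theory Num.Theory.
Local Open Scope ring_scope.

(* The free supercommutative algebra K[X;Y] = K[x1,x2,x1',x2'] (x) E(Y),     *)
(* Y = {y1,y2,y1',y2'}, is realised faithfully through its left regular      *)
(* representation: E(Y) has the basis e_S (S subset of {0,1,2,3}), encoded   *)
(* by the bits of c < 16; the odd generator y_k acts by left multiplication  *)
(*    y_k e_S = 0 if k in S,  (-1)^#{l in S | l < k} e_{S u {k}} otherwise.  *)
(* Hence K[X;Y] is (isomorphic to) the subalgebra of 16x16 matrices over     *)
(* {mpoly K[4]} generated by the scalar matrices 'X_l%:M and the ymat k.     *)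
(* Variable order: x1 = 'X_0, x2 = 'X_1, x1' = 'X_2, x2' = 'X_3,             *)
(*                 y1 = ymat 0, y2 = ymat 1, y1' = ymat 2, y2' = ymat 3.      *)

Definition bitn (k c : nat) : bool := odd (c %/ 2 ^ k).

Section SuperAlg.
Variable K : fieldType.

Definition Rp := {mpoly K[4]}.
Definition SA := 'M[Rp]_16.
Definition M2 := 'M[SA]_2.

Definition xvar (l : 'I_4) : SA := ('X_l : Rp)%:M.

Definition ymat (k : 'I_4) : SA :=
  \matrix_(r < 16, c < 16)
     (if ~~ bitn k c && (nat_of_ord r == c + 2 ^ k)%N
      then (-1) ^+ (\sum_(l < 4 | (l < k)%N) bitn l c)%N else 0).

Definition scal (a : K) : M2 := ((a%:MP : Rp)%:M : SA)%:M.

Definition o0 : 'I_4 := inord 0.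
Definition o1 : 'I_4 := inord 1.
Definition o2 : 'I_4 := inord 2.
Definition o3 : 'I_4 := inord 3.

Definition genC (x y y' x' : SA) : M2 :=
  \matrix_(i < 2, j < 2)
    (if i == 0 :> nat then (if j == 0 :> nat then x else y)
     else (if j == 0 :> nat then y' else x')).

Definition C1 : M2 := genC (xvar o0) (ymat o0) (ymat o2) (xvar o2).
Definition C2 : M2 := genC (xvar o1) (ymat o1) (ymat o3) (xvar o3).

(* Letters: false = t1, true = t2. A word is a seq bool;                    *)
(* an element of the free algebra K<t1,t2> is a finite formal sum of        *)
(* (coefficient, word).                                                     *)
Definition tC (b : bool) : M2 := if b then C2 else C1.
Definition word_eval (w : seq bool) : M2 := \prod_(b <- w) tC b.
Definition nc_eval (p : seq (K * seq bool)) : M2 :=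
  \sum_(q <- p) scal q.1 * word_eval q.2.

Definition inF (a : M2) : Prop := exists p, a = nc_eval p.

Definition central (a : M2) : Prop := forall b, inF b -> a * b = b * a.
Definition strongly_central (a : M2) : Prop :=
  central a /\ forall b, inF b -> central (a * b).

(* The left normed commutator [t1, t2, t_{s3}, ..., t_{sl}] is encoded by   *)
(* its tail s = [s3; ...; sl] (false = t1, true = t2).                       *)
Definition comm (a b : M2) : M2 := a * b - b * a.
Definition comm_eval (s : seq bool) : M2 :=
  foldl (fun acc c => comm acc (tC c)) (comm C1 C2) s.
Definition deg1 (s : seq bool) : nat := (count negb s).+1.
Definition deg2 (s : seq bool) : nat := (count id s).+1.

Definition fexpr (N : nat) (alpha : nat -> nat -> K)
  (B : seq ((nat * nat) * seq (K * seq bool)))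
  (G : seq ((K * (nat * nat)) * seq (seq bool))) : M2 :=
  \sum_(n < N.+1) \sum_(m < N.+1) scal (alpha n m) * (C1 ^+ n * C2 ^+ m)
  + \sum_(j <- B) C1 ^+ j.1.1 * C2 ^+ j.1.2 *
        \sum_(u <- j.2) scal u.1 * comm_eval u.2
  + \sum_(g <- G) scal g.1.1 * (C1 ^+ g.1.2.1 * C2 ^+ g.1.2.2) *
        \prod_(s <- g.2) comm_eval s.

End SuperAlg.

(* Main.v *)
Require Import Defs.
From HB Require Import structures.
From mathcomp Require Import all_boot all_order all_algebra.
From mathcomp Require Import mpoly ring.
Import Order.TTheory GRing.Theory Num.Theory.
Local Open Scope ring_scope.

(* Write d_i = x_i - x_i', z = d_1 y_2 - d_2 y_1, z' = d_1 y_2' - d_2 y_1'. A left normed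
   commutator u is [[W, n z], [-m z', W]], where m and n are products of the d_i and -d_i
   over its tail, and d_i W z = - m y_i z z', d_i W z' = n y_i' z z' for i = 1, 2. Hence a
   product of two commutators, or a difference of two commutators of equal bidegree,
   commutes with C_1, C_2 and is killed by [C_1, C_2]; the set of such elements is
   stable under multiplication by F, so it consists of strongly central elements. This
   gives sufficiency. For necessity, killing y_2, y_1', y_2' and reading y_1 as 1 sends F
   onto an algebra of upper triangular matrices with C_1 -> [[x_1, 1], [0, x_1']] and
   C_2 -> diag(x_2, x_2'). The image [[p, q], [0, s]] of a central element has q = 0 and
   p = s: p = s kills the alpha_nm, and q = 0 kills the sums of the beta_ij since
   x_1, x_2, d_1, d_2 are algebraically independent. *)

(** * Relations between the odd generators of the regular representation *)

Section Ymat.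

(* The entries of ymat as integers computable by vm_compute. *)
Definition yint (k r c : nat) : int :=
  if ~~ bitn k c && (r == c + 2 ^ k)%N
  then (-1) ^+ sumn [seq nat_of_bool (bitn l c) | l <- iota 0 k] else 0.

Lemma ymatE (K : fieldType) (k : 'I_4) (r c : 'I_16) :
  ymat K k r c = (yint k r c)%:~R.
Proof.
rewrite mxE /yint; case: ifP => // _.
rewrite rmorphXn /= rmorphN1; congr (_ ^+ _).
rewrite sumnE big_map.
rewrite -[X in iota 0 X]subn0 -/(index_iota 0 k) big_mkord.
by rewrite (big_ord_widen _ (fun i => nat_of_bool (bitn i c)) (ltnW (ltn_ord k))).
Qed.

(** An entry of a product of two [ymat], as a [foldr] over a concrete list of integers: big
    operators are locked and would block [vm_compute]. *)
Definition ymul (k l r c : nat) : int :=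
  foldr (fun j s => yint k r j * yint l j c + s) 0 (iota 0 16).

Lemma ymat_mulE (K : fieldType) (k l : 'I_4) (r c : 'I_16) :
  (ymat K k * ymat K l) r c = (ymul k l r c)%:~R.
Proof.
rewrite mxE.
transitivity ((\sum_(j < 16) yint k r j * yint l j c)%:~R : Rp K); last first.
  congr (_%:~R).
  rewrite -(big_mkord xpredT (fun j => yint k r j * yint l j c)).
  by rewrite unlock.
rewrite rmorph_sum; apply: eq_bigr => j _.
by rewrite !ymatE rmorphM.
Qed.

(** All entries are checked at once over the integers; the ring morphism from [int] carries the
    relations to every [K]. *)
Lemma ymul_anti_table :
  all (fun k => all (fun l => all (fun r => all (fun c =>
    (ymul k l r c == - ymul l k r c) && (ymul k k r c == 0))
  (iota 0 16)) (iota 0 16)) (iota 0 4)) (iota 0 4).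
Proof. by vm_compute. Qed.

Lemma ymul_anti (k l : 'I_4) (r c : 'I_16) :
  (ymul k l r c == - ymul l k r c) && (ymul k k r c == 0).
Proof.
have in_iota n (i : 'I_n) : val i \in iota 0 n by rewrite mem_iota /=.
move/allP: ymul_anti_table => /(_ _ (in_iota _ k)) /allP /(_ _ (in_iota _ l)).
by move=> /allP /(_ _ (in_iota _ r)) /allP /(_ _ (in_iota _ c)).
Qed.

Lemma ymat_anti (K : fieldType) (k l : 'I_4) :
  ymat K k * ymat K l = - (ymat K l * ymat K k).
Proof.
apply/matrixP=> r c; rewrite [RHS]mxE !ymat_mulE -rmorphN.
by have /andP[/eqP -> _] := ymul_anti k l r c.
Qed.

Lemma ymat_sq (K : fieldType) (k : 'I_4) : ymat K k * ymat K k = 0.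
Proof.
apply/matrixP=> r c; rewrite [RHS]mxE !ymat_mulE.
by have /andP[_ /eqP ->] := ymul_anti k k r c.
Qed.
End Ymat.

(** * Calculus with odd elements y, y', z, z' and with the entries of commutators *)

Section OddCalculus.
Variables (R : comNzRingType) (A : algType R) (y y' z z' : A).

Lemma mulr_anti (a b x : A) : a * b = - (b * a) -> x * a * b = - (x * b * a).
Proof. by move=> ab; rewrite -mulrA ab mulrN mulrA. Qed.

Lemma mulr_sq0 (a x : A) : a * a = 0 -> x * a * a = 0.
Proof. by move=> aa; rewrite -mulrA aa mulr0. Qed.

Lemma mulr_comm (a b x : A) : a * b = b * a -> x * a * b = x * b * a.
Proof. by move=> ab; rewrite -mulrA ab mulrA. Qed.

Hypotheses (yz : z * y = - (y * z)) (y'z : z * y' = - (y' * z))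
  (yz' : z' * y = - (y * z')) (y'z' : z' * y' = - (y' * z'))
  (yy' : y' * y = - (y * y')) (zz' : z' * z = - (z * z')).
Hypotheses (sy : y * y = 0) (sy' : y' * y' = 0) (sz : z * z = 0) (sz' : z' * z' = 0).

(** With [lin_rules] this gives a normal form: scalars and signs move to the front, products
    associate to the left, and odd factors are sorted as y, y', z, z'. The variants with a free x
    rewrite inside longer products. *)
Definition odd_rules :=
  (yz, y'z, yz', y'z', yy', zz', (sy, sy', sz, sz'),
   (fun x => mulr_anti _ _ x yz, fun x => mulr_anti _ _ x y'z,
    fun x => mulr_anti _ _ x yz', fun x => mulr_anti _ _ x y'z',
    fun x => mulr_anti _ _ x yy', fun x => mulr_anti _ _ x zz'),
   (fun x => mulr_sq0 _ x sy, fun x => mulr_sq0 _ x sy',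
    fun x => mulr_sq0 _ x sz, fun x => mulr_sq0 _ x sz')).

Definition lin_rules :=
  (@mulrA A, (=^~ scalerAl, =^~ scalerAr), @scalerA R A, (@mulNr A, @mulrN A), (@opprK A),
   @scalerN R A, @scaleNr R A, @oppr0 A, (@mulr0 A, @mul0r A), @scaler0 R A,
   (@addr0 A, @add0r A, @subr0 A, @sub0r A), (@mulrDl A, @mulrDr A), (@scalerDr R A, @opprD A)).

Ltac oddnf := rewrite ?(lin_rules, odd_rules).

(** As d is regular on A, an identity may be checked after multiplication by d; only d W z and d W
    z' have explicit formulas. *)
Variable d : R.
Hypothesis dI : forall v : A, d *: v = 0 -> v = 0.

Lemma scale_swap (a b : R) (v : A) : a *: (b *: v) = b *: (a *: v).
Proof. by rewrite !scalerA mulrC. Qed.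

(* The properties of the diagonal entry W of a commutator [[W, n z], [-m z', W]]; here
   y, y', d stand for y_i, y_i', d_i with i fixed. *)
Definition comm_diagonal (W : A) (n m : R) : Prop :=
  [/\ d *: (W * z) = - (m *: (y * z * z')), d *: (W * z') = n *: (y' * z * z'),
      W * y = y * W, W * y' = y' * W & W * z = z * W /\ W * z' = z' * W].

Lemma comm_diagonal_zz' W n m : comm_diagonal W n m -> W * z * z' = 0.
Proof.
case=> Wz _ _ _ _; apply: dI.
by rewrite scalerAl Wz; do 3 oddnf.
Qed.

Variables (W1 W2 w : A) (n1 m1 n2 m2 : R).
Hypotheses (B1 : comm_diagonal W1 n1 m1) (B2 : comm_diagonal W2 n2 m2).
Hypothesis (wE : d *: w = y * z' - z * y').

(** After multiplication by d, W_2 z becomes a multiple of y z z'. Then W_1 passes y and kills z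
    z'. *)
Lemma comm_diagonal2_z : W1 * W2 * z = 0.
Proof.
case: B1 B2 => [W1z W1z' W1y W1y' [W1Z W1Z']] [W2z W2z' W2y W2y' [W2Z W2Z']].
have:= comm_diagonal_zz' _ _ _ B1; rewrite -mulrA => W1zz.
apply: dI; rewrite -mulrA scalerAr W2z !(mulrN, =^~ scalerAr) !mulrA W1y.
by rewrite -!mulrA W1zz mulr0 scaler0 oppr0.
Qed.

Lemma comm_diagonal2_z' : W1 * W2 * z' = 0.
Proof.
case: B1 B2 => [W1z W1z' W1y W1y' [W1Z W1Z']] [W2z W2z' W2y W2y' [W2Z W2Z']].
have:= comm_diagonal_zz' _ _ _ B1; rewrite -mulrA => W1zz.
apply: dI; rewrite -mulrA scalerAr W2z' -scalerAr !mulrA W1y'.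
by rewrite -!mulrA W1zz mulr0 scaler0.
Qed.

(* [[P12, Q12], [Q12', P12']] is the product of two commutators. *)
Let P12 := (W1 * W2 + n1 *: z * - (m2 *: z')).
Let Q12 := (W1 * (n2 *: z) + n1 *: z * W2).
Let Q12' := (- (m1 *: z') * W2 + W1 * - (m2 *: z')).
Let P12' := (- (m1 *: z') * (n2 *: z) + W1 * W2).

Let d_Q12 : d *: Q12 = - ((n2 * m1 + n1 * m2) *: (y * z * z')).
Proof.
case: B1 B2 => [W1z _ _ _ [W1Z _]] [W2z _ _ _ [W2Z _]].
rewrite /Q12 -[W1 * (n2 *: z)]scalerAr -[n1 *: z * W2]scalerAl -W2Z.
rewrite scalerDr !(scale_swap d) W1z W2z.
by rewrite !scalerN !scalerA -opprD scalerDl.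
Qed.

Let d_Q12' : d *: Q12' = - ((n2 * m1 + n1 * m2) *: (y' * z * z')).
Proof.
case: B1 B2 => [_ W1z' _ _ [_ W1Z']] [_ W2z' _ _ [_ W2Z']].
rewrite /Q12' mulNr mulrN -scalerAr -scalerAl -W2Z'.
rewrite scalerDr !scalerN !(scale_swap d) W1z' W2z'.
by rewrite !scalerA -opprD scalerDl (mulrC m1) (mulrC m2).
Qed.

(** This lemma and the next three say, entry by entry, that the product of two commutators commutes
    with C_i. The scalars x_i, x_i' on the diagonal of C_i cancel except for d = x_i - x_i' times an
    off-diagonal entry. *)
Lemma commutator_entry01 : P12 * y - y * P12' = d *: Q12.
Proof.
case: B1 B2 => [_ _ W1y _ _] [_ _ W2y _ _].
rewrite d_Q12 /P12 /P12'.
do 3 oddnf; rewrite (mulr_comm _ _ _ W2y) W1y.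
by rewrite addrC addrA subrK -opprD scalerDl.
Qed.

Lemma commutator_entry10 : P12' * y' - y' * P12 = - (d *: Q12').
Proof.
case: B1 B2 => [_ _ _ W1y' _] [_ _ _ W2y' _].
rewrite d_Q12' /P12 /P12'.
do 3 oddnf; rewrite (mulr_comm _ _ _ W2y') W1y'.
by rewrite addrA addrK (mulrC m2) scalerDl.
Qed.

Lemma commutator_entry00 : Q12 * y' = y * Q12'.
Proof.
apply/eqP; rewrite -subr_eq0; apply/eqP/dI; rewrite scalerBr scalerAl [d *: (y * _)]scalerAr.
by rewrite d_Q12 d_Q12'; do 3 oddnf; rewrite addNr.
Qed.

Lemma commutator_entry11 : Q12' * y = y' * Q12.
Proof.
apply/eqP; rewrite -subr_eq0; apply/eqP/dI; rewrite scalerBr scalerAl [d *: (y' * _)]scalerAr.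
rewrite d_Q12 d_Q12'; do 3 oddnf; exact: subrr.
Qed.

Lemma comm_diagonal2_w : W1 * W2 * w = 0.
Proof.
have:= comm_diagonal2_z; have:= comm_diagonal2_z'.
case: B1 B2 => [_ _ W1y W1y' [W1Z W1Z']] [_ _ W2y W2y' [W2Z W2Z']] h' h.
apply: dI; rewrite scalerAr wE mulrBr !mulrA.
rewrite h mul0r subr0 (mulr_comm _ _ _ W2y) W1y -!mulrA.
by move: h'; rewrite -!mulrA => ->; rewrite mulr0.
Qed.

(** One factor d turns W z into a multiple of y z z', a second one turns w into y z' - z y'; each
    resulting monomial repeats an odd factor. *)
Lemma comm_diagonal_zw W n m : comm_diagonal W n m -> W * z * w = 0.
Proof.
case=> Wz _ _ _ _; apply: dI.
rewrite scalerAl Wz.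
by apply: dI; rewrite scalerAr wE; do 3 oddnf.
Qed.

Lemma comm_diagonal_z'w W n m : comm_diagonal W n m -> W * z' * w = 0.
Proof.
case=> _ Wz' _ _ _; apply: dI.
rewrite scalerAl Wz'.
by apply: dI; rewrite scalerAr wE; do 3 oddnf.
Qed.

Lemma zz'w : z * z' * w = 0.
Proof. by apply: dI; rewrite scalerAr wE; do 3 oddnf. Qed.

(** The four entries of the product of two commutators times [C_1, C_2] = [[w, z], [-z', w]]. After
    expansion every monomial contains one of the vanishing products above. *)
Lemma product_annihilates :
  [/\ P12 * w + Q12 * - z' = 0, P12 * z + Q12 * w = 0,
      Q12' * w + P12' * - z' = 0 & Q12' * z + P12' * w = 0].
Proof.
have W1zz := comm_diagonal_zz' _ _ _ B1; have W2zz := comm_diagonal_zz' _ _ _ B2.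
have W1zw := comm_diagonal_zw _ _ _ B1; have W2zw := comm_diagonal_zw _ _ _ B2.
have W1z'w := comm_diagonal_z'w _ _ _ B1; have W2z'w := comm_diagonal_z'w _ _ _ B2.
have W12z := comm_diagonal2_z; have W12z' := comm_diagonal2_z'; have W12w := comm_diagonal2_w.
have zzw := zz'w.
case: B1 B2 => [_ _ _ _ [W1Z W1Z']] [_ _ _ _ [W2Z W2Z']].
rewrite /P12 /P12' /Q12 /Q12'.
by split; do 4 rewrite ?(lin_rules, odd_rules, esym W2Z, esym W2Z', fun x => mulr_comm _ _ x (esym W2Z),
  fun x => mulr_comm _ _ x (esym W2Z'), W1zz, W2zz, W1zw, W2zw, W1z'w, W2z'w, W12z, W12z', W12w, zzw).
Qed.
End OddCalculus.

(** * Two by two matrices given by their entries *)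

Section Mx2.
Variable A : nzRingType.

Definition mx2 (a b c e : A) : 'M[A]_2 :=
  \matrix_(i < 2, j < 2)
    (if i == 0 :> nat then (if j == 0 :> nat then a else b)
     else (if j == 0 :> nat then c else e)).

Lemma mx2P (M : 'M[A]_2) : M = mx2 (M 0 0) (M 0 1) (M 1 0) (M 1 1).
Proof.
apply/matrixP=> i j; rewrite !mxE.
by case: i => [[|[|//]] ?]; case: j => [[|[|//]] ?] /=; congr (M _ _); apply: val_inj.
Qed.

Lemma mx2_mul a b c e a' b' c' e' :
  mx2 a b c e * mx2 a' b' c' e' =
  mx2 (a * a' + b * c') (a * b' + b * e') (c * a' + e * c') (c * b' + e * e').
Proof.
apply/matrixP=> i j; rewrite !mxE !big_ord_recl big_ord0 addr0 !mxE /=.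
by case: i => [[|[|//]] ?]; case: j => [[|[|//]] ?].
Qed.

Lemma mx2_sub a b c e a' b' c' e' :
  mx2 a b c e - mx2 a' b' c' e' = mx2 (a - a') (b - b') (c - c') (e - e').
Proof.
apply/matrixP=> i j; rewrite !mxE.
by case: i => [[|[|//]] ?]; case: j => [[|[|//]] ?].
Qed.

Lemma mx2_0 : mx2 0 0 0 0 = 0.
Proof.
apply/matrixP=> i j; rewrite !mxE.
by case: i => [[|[|//]] ?]; case: j => [[|[|//]] ?].
Qed.
End Mx2.
Arguments mx2 {A}.

(** * Commutators of two generic supermatrices over an abstract algebra with four odd elements *)

Section TwoGenerators.
Variables (R : comNzRingType) (A : algType R) (y : 'I_4 -> A) (x x' : bool -> R).
Hypotheses (y_anti : forall k l, y k * y l = - (y l * y k)) (y_sq : forall k, y k * y k = 0).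

Definition yy (b : bool) : A := y (if b then o1 else o0).
Definition yy' (b : bool) : A := y (if b then o3 else o2).
Definition xdiff (b : bool) : R := x b - x' b.
Hypothesis xdiff_reg : forall b (v : A), xdiff b *: v = 0 -> v = 0.

Definition super_gen (b : bool) : 'M[A]_2 := mx2 ((x b)%:A) (yy b) (yy' b) ((x' b)%:A).

Definition zz : A := xdiff false *: yy true - xdiff true *: yy false.
Definition zz' : A := xdiff false *: yy' true - xdiff true *: yy' false.
(** The diagonal entry of [C_1, C_2]; both diagonal entries agree because the y's anticommute. *)
Definition ww : A := yy false * yy' true - yy true * yy' false.

(** Since [A] carries no grading, parity is expressed by the commutation rule with the y's. *)
Definition odd_elt (a : A) := forall k, a * y k = - (y k * a).
Definition even_elt (a : A) := forall k, a * y k = y k * a.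

Lemma odd_y k : odd_elt (y k).
Proof. by move=> l. Qed.

Lemma odd_comb p q a b : odd_elt a -> odd_elt b -> odd_elt (p *: a - q *: b).
Proof.
move=> oa ob k; rewrite mulrBl mulrBr -!scalerAl -!scalerAr oa ob !scalerN.
by rewrite opprB opprK addrC.
Qed.

Lemma odd_zz : odd_elt zz. Proof. by apply: odd_comb; apply: odd_y. Qed.
Lemma odd_zz' : odd_elt zz'. Proof. by apply: odd_comb; apply: odd_y. Qed.

Lemma even_mul a b : odd_elt a -> odd_elt b -> even_elt (a * b).
Proof. by move=> oa ob k; rewrite -mulrA ob mulrN [in LHS]mulrA oa mulNr opprK mulrA. Qed.

Lemma even_comb p q a b : even_elt a -> even_elt b -> even_elt (p *: a + q *: b).
Proof. by move=> ea eb k; rewrite mulrDl mulrDr -!scalerAl -!scalerAr ea eb. Qed.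

Lemma odd_anti_zz a : odd_elt a -> a * zz = - (zz * a).
Proof.
move=> oa; rewrite /zz mulrBl mulrBr -!scalerAl -!scalerAr !oa !scalerN.
by rewrite opprB opprK addrC.
Qed.

Lemma odd_anti_zz' a : odd_elt a -> a * zz' = - (zz' * a).
Proof.
move=> oa; rewrite /zz' mulrBl mulrBr -!scalerAl -!scalerAr !oa !scalerN.
by rewrite opprB opprK addrC.
Qed.

Lemma even_comm_zz a : even_elt a -> a * zz = zz * a.
Proof. by move=> ea; rewrite /zz mulrBl mulrBr -!scalerAl -!scalerAr !ea. Qed.

Lemma even_comm_zz' a : even_elt a -> a * zz' = zz' * a.
Proof. by move=> ea; rewrite /zz' mulrBl mulrBr -!scalerAl -!scalerAr !ea. Qed.

Lemma sq_comb (p q : R) k l : (p *: y k - q *: y l) * (p *: y k - q *: y l) = 0.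
Proof.
rewrite mulrBl !mulrBr -!scalerAl -!scalerAr !y_sq !scaler0 (y_anti l k).
by rewrite !scalerN (@scale_swap _ _ q p) sub0r subr0 opprK addNr.
Qed.

Lemma zz_sq : zz * zz = 0. Proof. exact: sq_comb. Qed.
Lemma zz'_sq : zz' * zz' = 0. Proof. exact: sq_comb. Qed.

Lemma wwE b : xdiff b *: ww = yy b * zz' - zz * yy' b.
Proof.
rewrite /ww /zz /zz' mulrBr mulrBl -!scalerAl -!scalerAr.
case: b; rewrite scalerBr opprB; last by rewrite addrA addrNK.
by rewrite [RHS]addrC addrA subrK.
Qed.

(** The element d_b y_c - d_c y_b is 0, z or -z, and z squares to 0. The same argument with primes
    gives [zz'_xdiff]. *)
Lemma zz_xdiff b c : xdiff b *: (yy c * zz * zz') = xdiff c *: (yy b * zz * zz').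
Proof.
have h : (xdiff b *: yy c - xdiff c *: yy b) * zz = 0.
  case: b c => -[]; rewrite ?subrr ?mul0r //; last exact: zz_sq.
  by rewrite -opprB mulNr zz_sq oppr0.
by apply/eqP; rewrite -subr_eq0 !scalerAl -!mulrBl h mul0r.
Qed.

Lemma zz'_xdiff b c : xdiff b *: (yy' c * zz * zz') = xdiff c *: (yy' b * zz * zz').
Proof.
have h : (xdiff b *: yy' c - xdiff c *: yy' b) * zz' = 0.
  case: b c => -[]; rewrite ?subrr ?mul0r //; last exact: zz'_sq.
  by rewrite -opprB mulNr zz'_sq oppr0.
apply/eqP; rewrite -subr_eq0 -!mulrA (odd_anti_zz' _ odd_zz) !mulrN !mulrA !scalerN.
by rewrite -opprD !scalerAl -!mulrBl h mul0r oppr0.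
Qed.

Local Notation diagonal_at b := (comm_diagonal _ _ (yy b) (yy' b) zz zz' (xdiff b)).

Lemma zz_mul_yy b : zz * yy b = - (yy b * zz).
Proof. by rewrite (odd_anti_zz _ (odd_y _)) opprK. Qed.

Lemma zz_mul_yy' b : zz * yy' b = - (yy' b * zz).
Proof. by rewrite (odd_anti_zz _ (odd_y _)) opprK. Qed.

Lemma zz'_mul_yy b : zz' * yy b = - (yy b * zz').
Proof. by rewrite (odd_anti_zz' _ (odd_y _)) opprK. Qed.

Lemma zz'_mul_yy' b : zz' * yy' b = - (yy' b * zz').
Proof. by rewrite (odd_anti_zz' _ (odd_y _)) opprK. Qed.

Lemma zz'_mul_zz : zz' * zz = - (zz * zz').
Proof. exact: (odd_anti_zz _ odd_zz'). Qed.

(** The multipliers m ([xdiffs]) and n ([neg_xdiffs]): bracketing on the right with C_c multiplies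
    the lower left entry by d_c and the upper right one by -d_c, once the diagonal entry commutes
    with the y's. *)
Definition xdiffs (s : seq bool) : R := \prod_(c <- s) xdiff c.
Definition neg_xdiffs (s : seq bool) : R := \prod_(c <- s) - xdiff c.

Definition lie (a b : 'M[A]_2) := a * b - b * a.
Definition lie_eval (s : seq bool) :=
  foldl (fun acc c => lie acc (super_gen c)) (lie (super_gen false) (super_gen true)) s.

Lemma lie_eval_rcons s c : lie_eval (rcons s c) = lie (lie_eval s) (super_gen c).
Proof. by rewrite /lie_eval -cats1 foldl_cat. Qed.

Lemma even_ww : even_elt ww.
Proof.
move=> k; rewrite /ww mulrBl mulrBr.
by congr (_ - _); apply: even_mul; apply: odd_y.
Qed.

Lemma ww_comm_diagonal b : diagonal_at b ww 1 1.
Proof.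
split; [| |exact: even_ww|exact: even_ww|]; last 1 first.
- by split; [apply: even_comm_zz even_ww | apply: even_comm_zz' even_ww].
- rewrite scalerAl wwE mulrBl -!mulrA zz'_mul_zz (odd_anti_zz _ (odd_y _)).
  by rewrite !mulrN [zz * (zz * _)]mulrA zz_sq mul0r oppr0 subr0 scale1r !mulrA.
- rewrite scalerAl wwE mulrBl -!mulrA zz'_sq mulr0 sub0r scale1r !mulrA.
  by rewrite zz_mul_yy' mulNr opprK.
Qed.

Lemma lie_gen : lie (super_gen false) (super_gen true) = mx2 ww zz (- zz') ww.
Proof.
rewrite /lie !mx2_mul mx2_sub.
rewrite !mulr_algl !mulr_algr /ww /zz /zz' /xdiff !scalerBl.
congr mx2.
- by rewrite scale_swap opprD addrACA subrr add0r.
- by rewrite !opprD !opprK addrACA [RHS]addrACA [- _ + _]addrC.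
- by rewrite !opprB [RHS]addrACA opprD [- _ - _]addrC.
- have anti b c : yy' b * yy c = - (yy c * yy' b) by apply: y_anti.
  rewrite scale_swap opprD addrACA subrr addr0 !anti.
  by rewrite opprK addrC.
Qed.

Definition comm_form (s : seq bool) (W : A) :=
  [/\ lie_eval s = mx2 W (neg_xdiffs s *: zz) (- (xdiffs s *: zz')) W, even_elt W &
      forall b, diagonal_at b W (neg_xdiffs s) (xdiffs s)].

Lemma lie_evalP s : exists W, comm_form s W.
Proof.
elim/last_ind: s => [|s c [W [sE eW bW]]].
  exists ww; split; [|exact: even_ww|].
    by rewrite /lie_eval /= lie_gen /neg_xdiffs /xdiffs !big_nil !scale1r.
  by move=> b; rewrite /neg_xdiffs /xdiffs !big_nil; apply: ww_comm_diagonal.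
(* The diagonal entry of [[[W, n z], [-m z', W]], C_c]; W itself cancels against the scalars x_c and
   x_c'. *)
pose W' := neg_xdiffs s *: (zz * yy' c) + xdiffs s *: (yy c * zz').
have eW' : even_elt W' by apply: even_comb; apply: even_mul; apply: odd_zz || apply: odd_zz' || apply: odd_y.
exists W'; split=> // [|b].
  rewrite /lie_eval -cats1 foldl_cat /= -/(lie_eval s) sE /lie !mx2_mul mx2_sub.
  rewrite !mulr_algl !mulr_algr /neg_xdiffs /xdiffs !big_cat /= !big_seq1 -/(neg_xdiffs s) -/(xdiffs s).
  have [_ _ Wy Wy' _] := bW c.
  congr mx2.
  - by rewrite opprD addrACA subrr add0r mulrN opprK -scalerAl -scalerAr.
  - rewrite Wy [X in X - _]addrC [X in _ - X]addrC addrKA -scalerBl scalerA.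
    by rewrite mulrC opprB.
  - rewrite Wy' addrKA !scalerN opprK addrC -opprB -scalerBl scalerA.
    by rewrite mulrC.
  - rewrite opprD addrACA subrr addr0 mulNr -scalerAl zz'_mul_yy scalerN opprK -scalerAr.
    by rewrite (odd_anti_zz _ (odd_y _)) scalerN opprK addrC.
have mE : xdiffs (rcons s c) = xdiff c * xdiffs s by rewrite /xdiffs -cats1 big_cat big_seq1 mulrC.
have nE : neg_xdiffs (rcons s c) = - xdiff c * neg_xdiffs s.
  by rewrite /neg_xdiffs -cats1 big_cat big_seq1 mulrC.
rewrite mE nE; split; [| |exact: eW'|exact: eW'|]; last 1 first.
- by split; [apply: even_comm_zz eW' | apply: even_comm_zz' eW'].
(* Only the summand with z' survives multiplication by z; [zz_xdiff] trades d_b y_c for d_c y_b, and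
   d_c joins m. *)
- have e1 : zz * yy' c * zz = 0 by rewrite zz_mul_yy' mulNr -mulrA zz_sq mulr0 oppr0.
  have e2 : yy c * zz' * zz = - (yy c * zz * zz') by rewrite -mulrA zz'_mul_zz mulrN mulrA.
  rewrite /W' mulrDl -!scalerAl e1 e2 scaler0 add0r !scalerN scale_swap zz_xdiff scalerA.
  by rewrite (mulrC (xdiffs s)).
- have e1 : zz * yy' c * zz' = - (yy' c * zz * zz') by rewrite zz_mul_yy' mulNr.
  have e2 : yy c * zz' * zz' = 0 by rewrite -mulrA zz'_sq mulr0.
  rewrite /W' mulrDl -!scalerAl e1 e2 scaler0 addr0 !scalerN scale_swap zz'_xdiff scalerA.
  by rewrite mulNr scaleNr (mulrC (neg_xdiffs s)).
Qed.

Definition strong_annihilator (a : 'M[A]_2) :=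
  (forall b, a * super_gen b = super_gen b * a) /\ a * lie (super_gen false) (super_gen true) = 0.

Lemma annihilator_lie2 s1 s2 : strong_annihilator (lie_eval s1 * lie_eval s2).
Proof.
have [W1 [-> e1 B1]] := lie_evalP s1; have [W2 [-> e2 B2]] := lie_evalP s2.
have quad b : [/\ zz * yy b = - (yy b * zz), zz * yy' b = - (yy' b * zz),
    zz' * yy b = - (yy b * zz'), zz' * yy' b = - (yy' b * zz') &
    [/\ yy' b * yy b = - (yy b * yy' b), zz' * zz = - (zz * zz'),
      yy b * yy b = 0, yy' b * yy' b = 0 & zz * zz = 0 /\ zz' * zz' = 0]].
  split; [exact: zz_mul_yy|exact: zz_mul_yy'|exact: zz'_mul_yy|exact: zz'_mul_yy'|].
  by split; [exact: y_anti|exact: zz'_mul_zz|exact: y_sq|exact: y_sq|];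
    split; [exact: zz_sq|exact: zz'_sq].
rewrite mx2_mul; split=> [b|].
  have [q1 q2 q3 q4 [q5 q6 q7 q8 [q9 q10]]] := quad b.
  rewrite !mx2_mul !mulr_algl !mulr_algr.
  congr mx2.
  - by congr (_ + _); apply: (commutator_entry00 _ _ _ _ _ _ q2 q4 _ (xdiff_reg b)).
  - have /eqP := commutator_entry01 _ _ _ _ _ _ q1 q3 q6 _ _ _ _ _ _ _ (B1 b) (B2 b).
    by rewrite subr_eq => /eqP ->; rewrite addrAC -scalerDl subrK.
  - have /eqP := commutator_entry10 _ _ _ _ _ _ q2 q4 q6 _ _ _ _ _ _ _ (B1 b) (B2 b).
    by rewrite subr_eq => /eqP ->; rewrite addrA -scalerBl opprB [x b + _]addrC subrK addrC.
  - by congr (_ + _); apply: (commutator_entry11 _ _ _ _ _ _ q1 q3 q5 _ (xdiff_reg b)).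
rewrite lie_gen mx2_mul -[RHS]mx2_0.
(* No single generator C_b is involved here, so the formulas with d_1 alone suffice. *)
have [q1 q2 q3 q4 [q5 q6 q7 q8 [q9 q10]]] := quad false.
have [E1 E2 E3 E4] := product_annihilates _ _ _ _ _ _ q1 q2 q3 q4 q5 q6 q7 q8 q9 q10 _ (xdiff_reg false)
  _ _ _ _ _ _ _ (B1 false) (B2 false) (wwE false).
by rewrite E1 E2 E3 E4.
Qed.

(** The off-diagonal entries cancel and leave W = W_1 - W_2 on the diagonal. Since d_1 W_i z and d_1
    W_i z' depend only on m and n, W kills z and z', hence also d_1 w = y_1 z' - z y_1'. *)
Lemma annihilator_sub_lie s1 s2 : xdiffs s1 = xdiffs s2 -> neg_xdiffs s1 = neg_xdiffs s2 ->
  strong_annihilator (lie_eval s1 - lie_eval s2).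
Proof.
move=> ms ns.
have [W1 [-> e1 B1]] := lie_evalP s1; have [W2 [-> e2 B2]] := lie_evalP s2.
rewrite ms ns mx2_sub !subrr; set W := W1 - W2.
have Wz : W * zz = 0.
  case: (B1 false) (B2 false) => [E1 _ _ _ _] [E2 _ _ _ _].
  by apply: (xdiff_reg false); rewrite mulrBl scalerBr E1 E2 ms subrr.
have Wz' : W * zz' = 0.
  case: (B1 false) (B2 false) => [_ E1 _ _ _] [_ E2 _ _ _].
  by apply: (xdiff_reg false); rewrite mulrBl scalerBr E1 E2 ns subrr.
have eW : even_elt W by move=> k; rewrite mulrBl mulrBr e1 e2.
split=> [b|].
  by rewrite !mx2_mul !mulr_algl !mulr_algr !(mulr0, mul0r, scaler0, addr0, add0r) /yy /yy' !eW.
rewrite lie_gen mx2_mul !mul0r Wz mulrN Wz' oppr0 !add0r !addr0.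
have -> : W * ww = 0; last exact: mx2_0.
apply: (xdiff_reg false); rewrite scalerAr wwE mulrBr !mulrA Wz mul0r subr0.
by rewrite eW -mulrA Wz' mulr0.
Qed.

Lemma mx2_scalar_comm (p : R) (M : 'M[A]_2) : mx2 p%:A 0 0 p%:A * M = M * mx2 p%:A 0 0 p%:A.
Proof.
rewrite [M]mx2P !mx2_mul !mulr_algl !mulr_algr.
by rewrite !(mulr0, mul0r, addr0, add0r).
Qed.

(** Thus m, and likewise n below, depends only on the bidegree of the commutator. *)
Lemma xdiffsE s : xdiffs s = xdiff false ^+ count negb s * xdiff true ^+ count id s.
Proof.
rewrite /xdiffs; elim: s => [|[] s IHs] /=; rewrite ?big_nil ?mulr1 // big_cons IHs ?add0n ?add1n.
  by rewrite exprS mulrCA.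
by rewrite exprS mulrA.
Qed.

Lemma neg_xdiffsE s : neg_xdiffs s = (- xdiff false) ^+ count negb s * (- xdiff true) ^+ count id s.
Proof.
rewrite /neg_xdiffs; elim: s => [|[] s IHs] /=; rewrite ?big_nil ?mulr1 // big_cons IHs ?add0n ?add1n.
  by rewrite exprS mulrCA.
by rewrite exprS mulrA.
Qed.

Lemma super_gen_swap b c : exists k : int,
  super_gen b * super_gen c = super_gen c * super_gen b + lie (super_gen false) (super_gen true) *~ k.
Proof.
case: b c => -[]; [exists 0| exists (-1)|exists 1|exists 0]; rewrite /lie ?mulr0z ?addr0 //.
  by rewrite mulrNz mulr1z opprB addrC subrK.
by rewrite mulr1z addrC subrK.
Qed.

Lemma annihilator0 : strong_annihilator 0.
Proof. by split=> [b|]; rewrite !(mul0r, mulr0). Qed.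

Lemma annihilatorD a b : strong_annihilator a -> strong_annihilator b -> strong_annihilator (a + b).
Proof.
move=> [a1 a2] [b1 b2]; split=> [c|]; first by rewrite mulrDl mulrDr a1 b1.
by rewrite mulrDl a2 b2 addr0.
Qed.

Lemma annihilatorN a : strong_annihilator a -> strong_annihilator (- a).
Proof.
move=> [a1 a2]; split=> [c|]; first by rewrite mulNr mulrN a1.
by rewrite mulNr a2 oppr0.
Qed.

Lemma annihilator_sum I (r : seq I) (P : pred I) F :
  (forall i, P i -> strong_annihilator (F i)) -> strong_annihilator (\sum_(i <- r | P i) F i).
Proof. by move=> FJ; elim/big_ind: _ => // [|a b]; [exact: annihilator0 | exact: annihilatorD]. Qed.

Lemma annihilatorM_central t a : (forall b, t * super_gen b = super_gen b * t) ->
  strong_annihilator a -> strong_annihilator (t * a).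
Proof.
move=> tC [aC ac]; split=> [b|]; last by rewrite -mulrA ac mulr0.
by rewrite -mulrA aC mulrA tC mulrA.
Qed.

(** Here a C_b C_c = a C_c C_b, because the difference is an integer multiple of a [C_1, C_2] = 0.
    This is the purpose of the second condition in [strong_annihilator]. *)
Lemma annihilatorMr a b : strong_annihilator a -> strong_annihilator (a * super_gen b).
Proof.
move=> [aC ac]; split=> [c|]; last by rewrite aC -mulrA ac mulr0.
have [k E] := super_gen_swap b c.
by rewrite -mulrA E mulrDr mulrzAr ac mul0rz addr0 mulrA aC mulrA.
Qed.

Lemma annihilatorMl a b : strong_annihilator a -> strong_annihilator (super_gen b * a).
Proof. by move=> aJ; case: (aJ) => aC _; rewrite -aC; apply: annihilatorMr. Qed.

Lemma annihilatorMXl a b n : strong_annihilator a -> strong_annihilator (super_gen b ^+ n * a).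
Proof. by elim: n => [|n IHn] aJ; rewrite ?mul1r // exprS -mulrA; apply/annihilatorMl/IHn. Qed.

Lemma annihilatorM_lie a s : strong_annihilator a -> strong_annihilator (a * lie_eval s).
Proof.
have step t b : (forall a, strong_annihilator a -> strong_annihilator (a * t)) ->
    forall a, strong_annihilator a -> strong_annihilator (a * lie t (super_gen b)).
  move=> tJ a0 aJ; rewrite mulrBr !mulrA; apply: annihilatorD; first exact/annihilatorMr/tJ.
  exact/annihilatorN/tJ/annihilatorMr.
elim/last_ind: s a => [|s c IHs] a aJ; last by rewrite /lie_eval -cats1 foldl_cat; apply: step.
by apply: (step (super_gen false)) => // a0; apply: annihilatorMr.
Qed.

Lemma annihilator_prod_lie (g : seq (seq bool)) :
  (2 <= size g)%N -> strong_annihilator (\prod_(s <- g) lie_eval s).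
Proof.
case: g => [|s1 [|s2 g]] // _; elim/last_ind: g => [|g s IHg].
  by rewrite big_cons big_seq1; apply: annihilator_lie2.
by rewrite -!rcons_cons big_rcons; apply: annihilatorM_lie.
Qed.
End TwoGenerators.

(** * Sums grouped by a key, and distinctness of list entries and variables *)

Lemma sum_by_key_eq0 (V : nmodType) (I T : eqType) (r : seq I) (key : I -> T) (F : I -> V) :
  (forall i, i \in r -> \sum_(j <- r | key j == key i) F j = 0) ->
  \sum_(i <- r) F i = 0.
Proof.
move=> F0; transitivity (\sum_(i <- r) \sum_(k <- undup (map key r) | k == key i) F i).
  rewrite big_seq [RHS]big_seq; apply: eq_bigr => i ir.
  by rewrite -big_filter filter_pred1_uniq ?undup_uniq ?big_seq1 // mem_undup map_f.
rewrite (exchange_big_dep xpredT) //= big_seq big1 // => k.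
rewrite mem_undup => /mapP[i ir ->].
by rewrite (eq_bigl (fun j => key j == key i)) ?F0 // => j; rewrite eq_sym.
Qed.

Lemma uniq_map_inj (T U : eqType) (f : T -> U) (s : seq T) : uniq (map f s) ->
  {in s &, injective f}.
Proof.
elim: s => //= a s IHs /andP[fa us] x y'; rewrite !inE.
move=> /predU1P[->|xs] /predU1P[->|ys] // e; last exact: IHs.
  by case/negP: fa; rewrite e map_f.
by case/negP: fa; rewrite -e map_f.
Qed.

Lemma o_eqE : (((o0 == o1) = false) * ((o0 == o2) = false) * ((o0 == o3) = false)
  * ((o1 == o0) = false) * ((o1 == o2) = false) * ((o1 == o3) = false)
  * ((o2 == o0) = false) * ((o2 == o1) = false) * ((o2 == o3) = false)
  * ((o3 == o0) = false) * ((o3 == o1) = false) * ((o3 == o2) = false))%type.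
Proof. by rewrite -!val_eqE /= !inordK. Qed.

(** * The algebra F inside matrices over K[X;Y], and sufficiency of the conditions *)

Section Instance.
Variable K : fieldType.
Local Notation Rp := (Rp K).
Local Notation SA := (SA K).
Local Notation M2 := (M2 K).
Local Notation tC := (tC K).
Local Notation comm_eval := (comm_eval K).

Definition xx (b : bool) : Rp := 'X_(if b then o1 else o0).
Definition xx' (b : bool) : Rp := 'X_(if b then o3 else o2).
Local Notation dd := (xdiff Rp xx xx').
Local Notation gen := (super_gen Rp SA (ymat K) xx xx').
Local Notation lie_word := (lie_eval Rp SA (ymat K) xx xx').
Local Notation nn := (neg_xdiffs Rp xx xx').
Local Notation annihilator := (strong_annihilator Rp SA (ymat K) xx xx').

Lemma xdiff_neq0 b : dd b != 0.
Proof.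
apply/eqP=> /(congr1 (mcoeff U_(if b then o1 else o0))).
rewrite mcoeffB mcoeff0 /xx /xx' !mcoeffX.
case: b; rewrite eqxx eq_mnm1 -val_eqE /= !inordK //= subr0;
  by apply/eqP; rewrite oner_eq0.
Qed.

Lemma xdiff_reg b (v : SA) : dd b *: v = 0 -> v = 0.
Proof.
move=> /matrixP pv; apply/matrixP=> i j; rewrite [RHS]mxE.
by move: (pv i j); rewrite !mxE => /eqP; rewrite mulf_eq0 (negPf (xdiff_neq0 b)) => /eqP.
Qed.

Lemma tCE b : tC b = gen b.
Proof. by rewrite /super_gen !scalemx1; case: b. Qed.

Lemma comm_lie (a b : M2) : comm a b = lie Rp SA a b.
Proof. by []. Qed.

Lemma comm_eval_rcons s c : comm_eval (rcons s c) = comm (comm_eval s) (tC c).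
Proof. by rewrite /comm_eval -cats1 foldl_cat. Qed.

Lemma comm_eval_lie s : comm_eval s = lie_word s.
Proof.
elim/last_ind: s => [|s c IHs]; first by rewrite /lie_eval /= -!tCE.
rewrite comm_eval_rcons lie_eval_rcons IHs tCE; exact: comm_lie.
Qed.

Lemma scalE a : scal a = mx2 ((a%:MP : Rp) *: (1 : SA)) 0 0 ((a%:MP : Rp) *: (1 : SA)).
Proof.
rewrite scalemx1; apply/matrixP=> i j; rewrite !mxE.
by case: i => [[|[|//]] ?]; case: j => [[|[|//]] ?]; rewrite ?mulr1n ?mulr0n.
Qed.

Lemma scal_comm a (M : M2) : scal a * M = M * scal a.
Proof. by rewrite scalE; apply: mx2_scalar_comm. Qed.

Lemma word_eval_cons b w : word_eval K (b :: w) = tC b * word_eval K w.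
Proof. by rewrite /word_eval big_cons. Qed.

Lemma nc_eval_letter b : nc_eval [:: (1 : K, [:: b])] = tC b.
Proof.
by rewrite /nc_eval big_seq1 /word_eval big_seq1 /scal mpolyC1 mul1r.
Qed.

(** Centrality can be tested on C_1 and C_2, since they generate F together with the scalars. *)
Lemma centralP (a : M2) : (forall b, a * tC b = tC b * a) <-> central a.
Proof.
split=> [aC b [p ->]|aF b]; last by rewrite -nc_eval_letter; apply: aF; eexists.
rewrite /nc_eval mulr_sumr mulr_suml; apply: eq_bigr => -[c w] _ /=.
rewrite mulrA -scal_comm -mulrA -[RHS]mulrA; congr (_ * _).
elim: w => [|b' w IHw]; first by rewrite /word_eval big_nil mulr1 mul1r.
by rewrite word_eval_cons mulrA aC -!mulrA IHw.
Qed.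

Lemma central_annihilator (a : M2) : annihilator a -> central a.
Proof. by move=> [aC _]; apply/centralP=> b; rewrite tCE. Qed.

Lemma central_scal (a : K) : central (scal a).
Proof. by move=> b _; apply: scal_comm. Qed.

Lemma centralD (a b : M2) : central a -> central b -> central (a + b).
Proof. by move=> ca cb c Fc; rewrite mulrDl mulrDr ca // cb. Qed.

Lemma annihilatorM_inF (a b : M2) : annihilator a -> inF b -> annihilator (a * b).
Proof.
move=> aJ [p ->]; rewrite /nc_eval mulr_sumr; apply: annihilator_sum => -[c w] _ /=.
rewrite mulrA -scal_comm -mulrA; apply: annihilatorM_central; first by move=> b'; apply: scal_comm.
elim: w a aJ => [|b' w IHw] a aJ; first by rewrite /word_eval big_nil mulr1.
by rewrite word_eval_cons mulrA tCE; apply/IHw/annihilatorMr.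
Qed.

(** The tail of a chosen commutator [t_1, t_2, t_1, ..., t_1, t_2, ..., t_2] of bidegree k; the
    predecessors discount the two leading letters. *)
Definition canonical_tail (k : nat * nat) := nseq k.1.-1 false ++ nseq k.2.-1 true.

Lemma annihilator_sub_canonical s :
  annihilator (comm_eval s - comm_eval (canonical_tail (deg1 s, deg2 s))).
Proof.
rewrite !comm_eval_lie.
by apply: (annihilator_sub_lie _ _ _ _ _ (@ymat_anti K) (@ymat_sq K) xdiff_reg); rewrite ?xdiffsE ?neg_xdiffsE
  /canonical_tail !count_cat !count_nseq /= !mul0n !mul1n addn0 add0n.
Qed.

Lemma scalD : {morph @scal K : a b / a + b}.
Proof. by move=> a b; rewrite /scal mpolyCD !raddfD. Qed.

Lemma scal0 : @scal K 0 = 0.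
Proof. by rewrite /scal mpolyC0 !raddf0. Qed.

(** Each commutator may be replaced by its difference with the canonical one of its bidegree,
    because the canonical terms add up to 0 within each bidegree. *)
Lemma annihilator_comm_sum (r : seq (K * seq bool)) :
  (forall u, u \in r ->
     \sum_(p <- r | (deg1 p.2 == deg1 u.2) && (deg2 p.2 == deg2 u.2)) p.1 = 0) ->
  annihilator (\sum_(u <- r) scal u.1 * comm_eval u.2).
Proof.
move=> r0; pose key (u : K * seq bool) := (deg1 u.2, deg2 u.2).
pose cn (u : K * seq bool) : M2 := comm_eval (canonical_tail (key u)).
have -> : \sum_(u <- r) scal u.1 * comm_eval u.2 =
    \sum_(u <- r) scal u.1 * (comm_eval u.2 - cn u).
  have z : \sum_(u <- r) scal u.1 * cn u = 0.
    apply: (sum_by_key_eq0 _ _ _ _ key) => u ur.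
    have := r0 u ur => /(congr1 (@scal K)); rewrite scal0 (big_morph _ scalD scal0).
    rewrite (eq_bigl (fun p => key p == key u)) => [E|p]; last by rewrite /key xpair_eqE.
    under eq_bigr => p /eqP kp do rewrite /cn kp.
    by rewrite -mulr_suml E mul0r.
  under [RHS]eq_bigr do rewrite mulrBr.
  by rewrite sumrB z subr0.
apply: annihilator_sum => u _; apply: annihilatorM_central; first by move=> b; apply: scal_comm.
exact: annihilator_sub_canonical.
Qed.

Lemma sum_alpha_scalar (N : nat) (alpha : nat -> nat -> K) :
  (forall n m : nat, (n <= N)%N -> (m <= N)%N -> (1 <= n + m)%N -> alpha n m = 0) ->
  \sum_(n < N.+1) \sum_(m < N.+1) scal (alpha n m) * (C1 K ^+ n * C2 K ^+ m)
    = scal (alpha 0 0).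
Proof.
move=> alpha0; rewrite big_ord_recl [X in _ + X]big1 => [|n _]; last first.
  by rewrite big1 // => m _; rewrite alpha0 ?scal0 ?mul0r // -ltnS ltn_ord.
rewrite addr0 big_ord_recl [X in _ + X]big1 => [|m _]; last first.
  by rewrite alpha0 ?scal0 ?mul0r // -ltnS ltn_ord.
by rewrite addr0 !expr0 !mulr1.
Qed.

(** Sufficiency: the beta part and the gamma part are both annihilators, so f is a scalar plus a
    strongly central element. *)
Lemma annihilator_fexpr (N : nat) (alpha : nat -> nat -> K)
  (B : seq ((nat * nat) * seq (K * seq bool)))
  (G : seq ((K * (nat * nat)) * seq (seq bool))) :
  all (fun g => 2 <= size g.2)%N G ->
  (forall n m : nat, (n <= N)%N -> (m <= N)%N -> (1 <= n + m)%N -> alpha n m = 0) ->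
  (forall j, j \in B -> forall u, u \in j.2 ->
     \sum_(p <- j.2 | (deg1 p.2 == deg1 u.2) && (deg2 p.2 == deg2 u.2)) p.1 = 0) ->
  exists2 a : M2, annihilator a & fexpr N alpha B G = scal (alpha 0%N 0%N) + a.
Proof.
move=> G2 alpha0 B0; rewrite /fexpr -addrA.
rewrite (sum_alpha_scalar _ _ alpha0).
eexists; last by [].
have CE : (C1 K = gen false) * (C2 K = gen true) by split; rewrite -tCE.
rewrite !CE; apply: annihilatorD.
  rewrite big_seq; apply: annihilator_sum => j jB; rewrite -mulrA.
  by do 2 apply: annihilatorMXl; apply: annihilator_comm_sum; apply: B0.
rewrite big_seq; apply: annihilator_sum => g /(allP G2) g2.
rewrite -mulrA; apply: annihilatorM_central; first by move=> b; apply: scal_comm.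
rewrite -mulrA; do 2 apply: annihilatorMXl.
under eq_bigr do rewrite comm_eval_lie.
exact: (annihilator_prod_lie _ _ _ _ _ (@ymat_anti K) (@ymat_sq K) xdiff_reg).
Qed.

(** * The homomorphism from F onto upper triangular matrices *)

(* The row of 1 and y_1 * 1 is number 0, resp. 1. The row vectors (row 1, 0) and (0, row 0)
   span a space stable under right multiplication by F; acts_as a t says that a acts on it
   by the matrix t. *)
Definition qrow (i : 'I_2) : 'I_16 := if i == 0 then 1 else 0.

Definition acts_as (a : M2) (t : 'M[Rp]_2) :=
  forall i j k, a i j (qrow i) k = t i j *+ (k == qrow j).

Lemma acts_as_entry a t : acts_as a t -> forall i j, t i j = a i j (qrow i) (qrow j).
Proof. by move=> at_ i j; rewrite at_ eqxx. Qed.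

Lemma acts_as_inj a t u : acts_as a t -> acts_as a u -> t = u.
Proof. by move=> at_ au; apply/matrixP=> i j; rewrite (acts_as_entry _ _ at_) (acts_as_entry _ _ au). Qed.

Lemma acts_as0 : acts_as 0 0.
Proof. by move=> i j k; rewrite !mxE mul0rn. Qed.

Lemma acts_asD a b t u : acts_as a t -> acts_as b u -> acts_as (a + b) (t + u).
Proof. by move=> at_ bu i j k; rewrite !mxE at_ bu mulrnDl. Qed.

Lemma acts_asN a t : acts_as a t -> acts_as (- a) (- t).
Proof. by move=> at_ i j k; rewrite !mxE at_ mulNrn. Qed.

Lemma acts_asM a b t u : acts_as a t -> acts_as b u -> acts_as (a * b) (t * u).
Proof.
move=> at_ bu i j k; rewrite !mxE summxE -sumrMnl; apply: eq_bigr => l _.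
rewrite mxE (bigD1 (qrow l)) //= big1 => [|r rl]; last by rewrite at_ (negPf rl) mul0r.
by rewrite addr0 at_ eqxx bu mulrnAr.
Qed.

Lemma acts_as_sum I (r : seq I) F T :
  (forall i, acts_as (F i) (T i)) -> acts_as (\sum_(i <- r) F i) (\sum_(i <- r) T i).
Proof. by move=> FT; elim/big_rec2: _ => [|i t a _]; [exact: acts_as0 | exact: acts_asD]. Qed.

Lemma acts_as_scal a : acts_as (scal a) (mx2 a%:MP 0 0 a%:MP).
Proof.
move=> i j k; rewrite !mxE.
by case: i => [[|[|//]] ?]; case: j => [[|[|//]] ?];
  rewrite ?mulr1n ?mulr0n ?mxE ?mul0rn //= eq_sym.
Qed.

Definition ut (p q s : Rp) : 'M[Rp]_2 := mx2 p q 0 s.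

Lemma ut_mul p q s p' q' s' :
  ut p q s * ut p' q' s' = ut (p * p') (p * q' + q * s') (s * s').
Proof. by rewrite /ut mx2_mul !(mulr0, mul0r, addr0, add0r). Qed.

Lemma ut_inj p q s p' q' s' : ut p q s = ut p' q' s' -> [/\ p = p', q = q' & s = s'].
Proof.
move=> /matrixP E.
by have := (E 0 0, E 0 1, E 1 1); rewrite !mxE /= => -[[-> ->] ->].
Qed.

Lemma acts_as_C b : acts_as (tC b) (ut (xx b) (~~ b)%:R (xx' b)).
Proof.
(* The nonzero entries of the matrix [ymat K l] lie in rows of index at least 2^l, so for l > 0 rows
   0 and 1 vanish: y_2, y_1', y_2' act as 0. *)
have Y (l : 'I_4) (n : nat) (k : 'I_16) : l = n :> nat -> (0 < n)%N ->
    forall r : 'I_16, (r < 2)%N -> ymat K l r k = 0.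
  move=> ln n0 r r2; rewrite mxE ln; case: andP => // -[_ /eqP rE].
  by move: r2; rewrite rE ltnNge (leq_trans _ (leq_addl _ _)) // -(expn1 2) leq_exp2l.
move=> i j k; rewrite tCE !mxE /qrow.
case: i => [[|[|//]] ?]; case: j => [[|[|//]] ?] /=.
- by rewrite !mxE eq_sym mulr_natr.
- rewrite /yy; case: b => /=; first by rewrite (Y o1 1) ?inordK // mul0rn.
  rewrite mxE inordK // addn1 eqSS [RHS]mulrb eq_sym.
  have -> : (k == 0) = (k == 0%N :> nat) by [].
  case: (nat_of_ord k =P 0%N) => [->|_]; last by rewrite andbF.
  by rewrite /bitn /= big_pred0.
- by rewrite /yy'; case: b; [rewrite (Y o3 3)|rewrite (Y o2 2)]; rewrite ?inordK // mul0rn.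
- by rewrite !mxE eq_sym mulr_natr.
Qed.

Lemma acts_as_comm a b t u : acts_as a t -> acts_as b u -> acts_as (comm a b) (t * u - u * t).
Proof. by move=> at_ bu; apply: acts_asD; [apply: acts_asM | apply/acts_asN/acts_asM]. Qed.

Lemma ut_sub p q s p' q' s' : ut p q s - ut p' q' s' = ut (p - p') (q - q') (s - s').
Proof. by rewrite /ut mx2_sub subr0. Qed.

(** The corner of the image of [C_1, C_2] is -d_2, and each further bracket with C_c multiplies the
    corner by -d_c. *)
Lemma acts_as_comm_eval s : acts_as (comm_eval s) (ut 0 (- dd true * nn s) 0).
Proof.
elim/last_ind: s => [|s c IHs].
  have := acts_as_comm _ _ _ _ (acts_as_C false) (acts_as_C true).
  rewrite !ut_mul ut_sub /nn big_nil mulr1 /dd /=.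
  by rewrite (mulrC (xx true)) (mulrC (xx' true)) !subrr mulr0 mul0r mulr1 mul1r add0r addr0 opprB.
rewrite comm_eval_rcons.
have := acts_as_comm _ _ _ _ IHs (acts_as_C c); rewrite !ut_mul ut_sub !mul0r !mulr0 subrr add0r addr0.
rewrite /nn -cats1 big_cat big_seq1 /dd.
set q := (X in ut _ X _) => h.
suff -> : - xdiff Rp xx xx' true * (\prod_(b <- s) - xdiff Rp xx xx' b * - (xx c - xx' c)) = q by [].
by rewrite /q /xdiff; ring.
Qed.

Lemma acts_as_CX b n : exists q, acts_as (tC b ^+ n) (ut (xx b ^+ n) q (xx' b ^+ n)).
Proof.
elim: n => [|n [q IHn]].
  exists 0; have := acts_as_scal 1.
  by rewrite /scal mpolyC1 /ut.
eexists; rewrite !exprS; have := acts_asM _ _ _ _ (acts_as_C b) IHn; rewrite ut_mul; apply.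
Qed.

Lemma acts_as_CXX n m : exists q, acts_as (C1 K ^+ n * C2 K ^+ m)
  (ut (xx false ^+ n * xx true ^+ m) q (xx' false ^+ n * xx' true ^+ m)).
Proof.
have [q1 h1] := acts_as_CX false n; have [q2 h2] := acts_as_CX true m.
by eexists; have := acts_asM _ _ _ _ h1 h2; rewrite ut_mul; apply.
Qed.

(** Commuting with diag(x_2, x_2') gives d_2 q = 0; then commuting with the image of C_1, whose
    corner is 1, gives p = s. *)
Lemma acts_as_central a p q s : acts_as a (ut p q s) -> central a -> q = 0 /\ p = s.
Proof.
move=> h /centralP aC.
have E b : ut p q s * ut (xx b) (~~ b)%:R (xx' b) = ut (xx b) (~~ b)%:R (xx' b) * ut p q s.
  by apply: acts_as_inj (acts_asM _ _ _ _ h (acts_as_C b)) _; rewrite aC; apply: acts_asM (acts_as_C b) h.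
have q0 : q = 0.
  have := E true; rewrite !ut_mul => /ut_inj[_ /eqP + _].
  rewrite mulr0 mul0r add0r addr0 mulrC -subr_eq0 -mulrBl mulf_eq0 => /orP[|/eqP //].
  by rewrite -oppr_eq0 opprB (negPf (xdiff_neq0 true)).
split=> //; have := E false; rewrite !ut_mul => /ut_inj[_ + _].
by rewrite q0 mulr0 mul0r addr0 add0r mulr1 mul1r.
Qed.

(** * Necessity: the coefficients of a central element *)

Section Coefficients.
Variables (N : nat) (alpha : nat -> nat -> K)
  (B : seq ((nat * nat) * seq (K * seq bool)))
  (G : seq ((K * (nat * nat)) * seq (seq bool))).
Hypothesis G2 : all (fun g => 2 <= size g.2)%N G.

Lemma ut0 : ut 0 0 0 = 0. Proof. exact: mx2_0. Qed.

Lemma ut_add p q s p' q' s' : ut p q s + ut p' q' s' = ut (p + p') (q + q') (s + s').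
Proof.
have -> : ut p' q' s' = - ut (- p') (- q') (- s').
  by rewrite -[RHS]add0r -ut0 ut_sub !sub0r !opprK.
by rewrite ut_sub !opprK.
Qed.

Lemma acts_as_ut_sum I (r : seq I) (F : I -> M2) (p q s : I -> Rp) :
  (forall i, acts_as (F i) (ut (p i) (q i) (s i))) ->
  acts_as (\sum_(i <- r) F i) (ut (\sum_(i <- r) p i) (\sum_(i <- r) q i) (\sum_(i <- r) s i)).
Proof.
move=> h; have := acts_as_sum _ r _ _ h.
suff -> : \sum_(i <- r) ut (p i) (q i) (s i) =
  ut (\sum_(i <- r) p i) (\sum_(i <- r) q i) (\sum_(i <- r) s i) by [].
by elim: r => [|i r IHr]; rewrite ?big_nil ?ut0 // !big_cons IHr ut_add.
Qed.

Lemma acts_as_ut_sum0 I (r : seq I) (F : I -> M2) (q : I -> Rp) :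
  (forall i, acts_as (F i) (ut 0 (q i) 0)) ->
  acts_as (\sum_(i <- r) F i) (ut 0 (\sum_(i <- r) q i) 0).
Proof. by move=> h; have := acts_as_ut_sum _ r _ _ _ _ h; rewrite !big1_eq. Qed.

Lemma acts_as_sum0 (I : eqType) (r : seq I) (F : I -> M2) :
  (forall i, i \in r -> acts_as (F i) 0) -> acts_as (\sum_(i <- r) F i) 0.
Proof.
by move=> h; rewrite big_seq; elim/big_ind: _ => // [|a b ra rb];
  [exact: acts_as0 | rewrite -[0]addr0; apply: acts_asD].
Qed.

(** The image of f has the values of [P] at (x_1, x_2) and (x_1', x_2') on its diagonal, and the
    beta part contributes -d_2 [Q] to its corner. *)
Let P (x1 x2 : Rp) := \sum_(n < N.+1) \sum_(m < N.+1) (alpha n m)%:MP * (x1 ^+ n * x2 ^+ m).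
Let Q := \sum_(j <- B) xx false ^+ j.1.1 * xx true ^+ j.1.2 *
   \sum_(u <- j.2) u.1%:MP * nn u.2.

Lemma acts_as_scalM (c : K) a p q s : acts_as a (ut p q s) ->
  acts_as (scal c * a) (ut (c%:MP * p) (c%:MP * q) (c%:MP * s)).
Proof.
move=> h; have := acts_asM _ _ _ _ (acts_as_scal c) h.
by rewrite -/(ut c%:MP 0 c%:MP) ut_mul mul0r addr0.
Qed.

Lemma acts_as_alpha_part : exists q, acts_as
  (\sum_(n < N.+1) \sum_(m < N.+1) scal (alpha n m) * (C1 K ^+ n * C2 K ^+ m))
  (ut (P (xx false) (xx true)) q (P (xx' false) (xx' true))).
Proof.
have acts_as_ord n (F : 'I_n -> M2) (p s : 'I_n -> Rp) :
    (forall i, exists q, acts_as (F i) (ut (p i) q (s i))) ->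
    exists q, acts_as (\sum_(i < n) F i) (ut (\sum_(i < n) p i) q (\sum_(i < n) s i)).
  elim: n F p s => [|n IHn] F p s h.
    by exists 0; rewrite !big_ord0 ut0; apply: acts_as0.
  have [q1 h1] := IHn (fun i => F (lift ord0 i)) _ _ (fun i => h (lift ord0 i)).
  have [q2 h2] := h ord0.
  by exists (q2 + q1); rewrite !big_ord_recl -ut_add; apply: acts_asD.
apply: (acts_as_ord) => n; apply: (acts_as_ord) => m.
by have [q h] := acts_as_CXX n m; eexists; apply: acts_as_scalM h.
Qed.

Lemma acts_as_beta_part :
  acts_as (\sum_(j <- B) C1 K ^+ j.1.1 * C2 K ^+ j.1.2 *
        \sum_(u <- j.2) scal u.1 * comm_eval u.2) (ut 0 (- dd true * Q) 0).
Proof.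
rewrite /Q mulr_sumr; apply: acts_as_ut_sum0 => j.
have h : acts_as (\sum_(u <- j.2) scal u.1 * comm_eval u.2)
    (ut 0 (\sum_(u <- j.2) - dd true * (u.1%:MP * nn u.2)) 0).
  apply: acts_as_ut_sum0 => u; have := acts_as_scalM u.1 _ _ _ _ (acts_as_comm_eval u.2).
  by rewrite mulr0 mulrCA.
have [q hq] := acts_as_CXX j.1.1 j.1.2.
have := acts_asM _ _ _ _ hq h; rewrite ut_mul !mulr0 addr0 -mulr_sumr.
by rewrite [_ * (- _ * _)]mulrCA.
Qed.

(** Commutators act by strictly upper triangular matrices, and the product of two of these is 0. *)
Lemma acts_as_gamma_part :
  acts_as (\sum_(g <- G) scal g.1.1 * (C1 K ^+ g.1.2.1 * C2 K ^+ g.1.2.2) *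
        \prod_(s <- g.2) comm_eval s) 0.
Proof.
apply: acts_as_sum0 => -[[c [n m]] g] /(allP G2) /=.
case: g => [|s1 [|s2 g]] // _.
have [q hq] := acts_as_CXX n m.
have {}hq := acts_as_scalM c _ _ _ _ hq.
rewrite !big_cons (mulrA (comm_eval s1)).
have h12 : acts_as (comm_eval s1 * comm_eval s2) 0.
  have := acts_asM _ _ _ _ (acts_as_comm_eval s1) (acts_as_comm_eval s2).
  by rewrite ut_mul !mulr0 mul0r addr0 ut0.
have [t ht] : exists t, acts_as (\prod_(s <- g) comm_eval s) t.
  elim: g => [|s g [t ht]]; rewrite ?big_nil ?big_cons.
    by exists (ut 1 0 1); have := acts_as_scal (1 : K); rewrite /scal mpolyC1.
  by eexists; apply: acts_asM ht; apply: acts_as_comm_eval.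
have := acts_asM _ _ _ _ hq (acts_asM _ _ _ _ h12 ht).
by rewrite mul0r mulr0.
Qed.

Lemma acts_as_fexpr q : acts_as
  (\sum_(n < N.+1) \sum_(m < N.+1) scal (alpha n m) * (C1 K ^+ n * C2 K ^+ m))
  (ut (P (xx false) (xx true)) q (P (xx' false) (xx' true))) ->
  acts_as (fexpr N alpha B G) (ut (P (xx false) (xx true)) (q - dd true * Q) (P (xx' false) (xx' true))).
Proof.
move=> h; have := acts_asD _ _ _ _ (acts_asD _ _ _ _ h acts_as_beta_part) acts_as_gamma_part.
by rewrite ut_add !addr0 mulNr.
Qed.

(** The two sides involve disjoint sets of variables; for n + m > 0 the monomial x_1^n x_2^m cannot
    occur on the right. *)
Lemma alpha_eq0 : P (xx false) (xx true) = P (xx' false) (xx' true) ->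
  forall n m : nat, (n <= N)%N -> (m <= N)%N -> (1 <= n + m)%N -> alpha n m = 0.
Proof.
move=> E n m nN mN nm.
pose mon (i j : 'I_4) n m : 'X_{1..4} := (U_(i) *+ n + U_(j) *+ m)%MM.
have PE (i j : 'I_4) k : (P 'X_i 'X_j)@_k =
    \sum_(n < N.+1) \sum_(m < N.+1) alpha n m * (mon i j n m == k)%:R.
  rewrite raddf_sum; apply: eq_bigr => a _; rewrite raddf_sum; apply: eq_bigr => b _.
  by rewrite /= mcoeffCM !mpolyXn -mpolyXD mcoeffX.
move/(congr1 (mcoeff (mon o0 o1 n m))): E; rewrite !PE.
have monE (i j : 'I_4) a b l : mon i j a b l = ((i == l) * a + (j == l) * b)%N.
  by rewrite /mon mnmDE !mulmnE !mnm1E.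
have -> : \sum_(a < N.+1) \sum_(b < N.+1) alpha a b * (mon o2 o3 a b == mon o0 o1 n m)%:R = 0.
  rewrite big1 // => a _; rewrite big1 // => b _; case: eqP => [e|]; last by rewrite mulr0.
  have := (congr1 (fun k : 'X_{1..4} => k o0) e, congr1 (fun k : 'X_{1..4} => k o1) e).
  rewrite !monE !o_eqE !eqxx !mul0n !mul1n !addn0 !add0n => -[z1 z2].
  by rewrite -z1 -z2 in nm.
have key a b : (mon o0 o1 a b == mon o0 o1 n m) = (a == n) && (b == m).
  apply/eqP/andP=> [e|[/eqP -> /eqP ->] //].
  have := (congr1 (fun k : 'X_{1..4} => k o0) e, congr1 (fun k : 'X_{1..4} => k o1) e).
  by rewrite !monE !o_eqE !eqxx !mul0n !mul1n !addn0 !add0n => -[-> ->].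
rewrite (bigD1 (inord n)) //= [X in _ + X = _]big1 => [|a an]; last first.
  rewrite big1 // => b _; rewrite key andbC.
  case: eqP => _; rewrite ?mulr0 //=; case: eqP => [e|]; rewrite ?mulr0 //.
  by case/eqP: an; apply: val_inj; rewrite /= e inordK.
rewrite addr0 (bigD1 (inord m)) //= [X in _ + X = _]big1 => [|b bm]; last first.
  rewrite key; case: eqP => _; rewrite ?mulr0 //=; case: eqP => [e|]; rewrite ?mulr0 //.
  by case/eqP: bm; apply: val_inj; rewrite /= e inordK.
by rewrite key !inordK // !eqxx mulr1 addr0.
Qed.

Hypothesis uniqB : uniq [seq j.1 | j <- B].

(** A change of variables turns each term of [Q] into a scalar times x_1^n x_2^m x_1'^a x_2'^b,
    where (n, m) is the pair of j and (a, b) counts the letters of the tail. *)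
Lemma beta_eq0 : Q = 0 -> forall j, j \in B -> forall u, u \in j.2 ->
  \sum_(p <- j.2 | (deg1 p.2 == deg1 u.2) && (deg2 p.2 == deg2 u.2)) p.1 = 0.
Proof.
move=> Q0 j jB u uj.
(* x_i' := x_i + x_i' turns -d_i into a variable. *)
pose lq : 4.-tuple Rp := [tuple 'X_o0; 'X_o1; 'X_o0 + 'X_o2; 'X_o1 + 'X_o3].
pose mon n m a b : 'X_{1..4} := (U_(o0) *+ n + U_(o1) *+ m + (U_(o2) *+ a + U_(o3) *+ b))%MM.
have lqE k : (k < 4)%N -> 'X_(inord k) \mPo lq = lq`_k.
  by move=> k4; rewrite comp_mpolyXU inordK.
have compM (p q : Rp) : (p * q) \mPo lq = (p \mPo lq) * (q \mPo lq).
  exact: (rmorphM (comp_mpoly lq)).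
have compX (p : Rp) n : (p ^+ n) \mPo lq = (p \mPo lq) ^+ n.
  exact: (rmorphXn (comp_mpoly lq)).
have compE b : (xx b \mPo lq = xx b) * ((- dd b) \mPo lq = xx' b).
  rewrite /xdiff opprB comp_mpolyB /xx /xx'.
  by case: b; rewrite !lqE //= addrC addKr.
have E : \sum_(j <- B) \sum_(p <- j.2) p.1%:MP *
    'X_[mon j.1.1 j.1.2 (count negb p.2) (count id p.2)] = 0 :> Rp.
  have E0 := congr1 (comp_mpoly lq) Q0; rewrite comp_mpoly0 in E0; apply: etrans E0.
  rewrite /Q (raddf_sum (comp_mpoly lq)); apply: eq_bigr => i _.
  rewrite /= !compM !compX (raddf_sum (comp_mpoly lq)) mulr_sumr; apply: eq_bigr => p _.
  rewrite /= compM comp_mpolyC neg_xdiffsE !compM !compX !compE /xx /xx' /mon.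
  by rewrite !mpolyXD -!mpolyXn; ring.
have monE n m a b l : mon n m a b l =
    ((o0 == l) * n + (o1 == l) * m + ((o2 == l) * a + (o3 == l) * b))%N.
  by rewrite /mon !mnmDE !mulmnE !mnm1E.
have key n m a b n' m' a' b' : (mon n m a b == mon n' m' a' b') =
    ((n, m) == (n', m')) && ((a == a') && (b == b')).
  apply/eqP/andP=> [e|[/eqP[-> ->] /andP[/eqP -> /eqP ->]] //].
  have := (congr1 (fun k : 'X_{1..4} => k o0) e, congr1 (fun k : 'X_{1..4} => k o1) e,
    congr1 (fun k : 'X_{1..4} => k o2) e, congr1 (fun k : 'X_{1..4} => k o3) e).
  rewrite !monE !o_eqE !eqxx !mul0n !mul1n !addn0 !add0n.
  by move=> [[[-> ->] ->] ->]; rewrite !eqxx.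
(* To this coefficient only j contributes, as the pairs in [B] are distinct, and within j exactly
   the commutators of the bidegree of u. *)
have := congr1 (mcoeff (mon j.1.1 j.1.2 (count negb u.2) (count id u.2))) E.
rewrite mcoeff0 raddf_sum (bigD1_seq j) ?(map_uniq uniqB) //= [X in _ + X = _]big1_seq => [|i /andP[ij iB]].
  rewrite addr0 raddf_sum => E'; rewrite -[RHS]E' big_mkcond; apply: eq_bigr => p _.
  rewrite /= mcoeffCM mcoeffX key eqxx /= /deg1 /deg2 !eqSS.
  by case: ifP; rewrite ?mulr1 ?mulr0.
rewrite raddf_sum big1 // => p _; rewrite /= mcoeffCM mcoeffX key -!surjective_pairing.
case: eqP => [e|_]; rewrite ?mulr0 //.
by case/eqP: ij; apply: (uniq_map_inj _ _ _ _ uniqB).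
Qed.

Lemma acts_as_fexpr_central : central (fexpr N alpha B G) ->
  [/\ forall n m : nat, (n <= N)%N -> (m <= N)%N -> (1 <= n + m)%N -> alpha n m = 0,
      forall j, j \in B -> forall u, u \in j.2 ->
        \sum_(p <- j.2 | (deg1 p.2 == deg1 u.2) && (deg2 p.2 == deg2 u.2)) p.1 = 0 &
      acts_as (fexpr N alpha B G) (ut (alpha 0 0)%:MP 0 (alpha 0 0)%:MP)].
Proof.
move=> fC; have [q hq] := acts_as_alpha_part.
have [_ /alpha_eq0 a0] := acts_as_central _ _ _ _ (acts_as_fexpr _ hq) fC.
(* The alpha part is now the scalar alpha_00, so its corner q, unspecified so far, is 0; the corner
   of f is then -d_2 [Q]. *)
move: (hq); rewrite {1}(sum_alpha_scalar _ _ a0) => /acts_as_inj /(_ (acts_as_scal _)).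
move=> /ut_inj[E1 q0 E2]; rewrite {}q0 in hq.
have := acts_as_fexpr _ hq; rewrite E1 E2 sub0r => hf.
have [/eqP Q0 _] := acts_as_central _ _ _ _ hf fC.
move: Q0; rewrite oppr_eq0 mulf_eq0 (negPf (xdiff_neq0 true)) => /eqP Q0.
split=> //; first exact: beta_eq0.
by move: hf; rewrite Q0 mulr0 oppr0.
Qed.

End Coefficients.
End Instance.

Theorem theorem1 (K : fieldType)
  (K_infinite : forall s : seq K, exists x : K, x \notin s)
  (K_char : 2 \notin [pchar K])
  (N : nat) (alpha : nat -> nat -> K)
  (B : seq ((nat * nat) * seq (K * seq bool)))
  (G : seq ((K * (nat * nat)) * seq (seq bool))) :
  uniq [seq j.1 | j <- B] ->
  all (fun g => 2 <= size g.2)%N G ->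
  let f := fexpr N alpha B G in
  (central f <->
     (forall n m : nat, (n <= N)%N -> (m <= N)%N -> (1 <= n + m)%N ->
        alpha n m = 0)
     /\ (forall j, j \in B -> forall u, u \in j.2 ->
          \sum_(p <- j.2 | (deg1 p.2 == deg1 u.2) && (deg2 p.2 == deg2 u.2))
             p.1 = 0))
  /\ (strongly_central f <-> central f /\ alpha 0%N 0%N = 0).
Proof.
move=> uniqB G2 f.
have necessary := acts_as_fexpr_central K N alpha B G G2 uniqB.
have sufficient := annihilator_fexpr K N alpha B G G2.
split.
  split=> [/necessary[a0 b0 _] // | [/sufficient h /h[a aJ E]]].
  by rewrite /f E; apply: centralD; [apply: central_scal | apply: central_annihilator].
split=> [[fC fsC]|[fC a00]].
  split=> //; have [_ _ fE] := necessary fC.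
  have FC1 : inF (C1 K) by exists [:: (1, [:: false])]; rewrite nc_eval_letter.
  (* The central element f C_1 acts with corner alpha_00, which must therefore vanish. *)
  have := acts_asM _ _ _ _ _ fE (acts_as_C K false); rewrite ut_mul mulr1 mul0r addr0.
  by move=> /acts_as_central /(_ (fsC _ FC1)) [/eqP + _]; rewrite mpolyC_eq0 => /eqP.
split=> [|b Fb]; first exact: fC.
(* With alpha_00 = 0, f itself is an annihilator, and so is every f b with b in F. *)
have [a0 b0 _] := necessary fC; have [a aJ E] := sufficient a0 b0.
by rewrite /f E a00 scal0 add0r; apply/central_annihilator/annihilatorM_inF.
Qed.
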